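(* Let $E_I^*\in\mathbb{R}^m_{>0}$, let $K_I$ be diagonal with negative diagonal entries, let $\tau_I$ be diagonal with positive diagonal entries, and let $Q_L(E_L)=(Q_1(E_1),\dots,Q_n(E_n))$ be a static load model with each $Q_i$ smooth. Consider the closed-loop differential-algebraic system $$\begin{pmatrix}\mathbf 0_n\\ \tau_I\dot E_I\end{pmatrix}=\begin{pmatrix}Q_L(E_L)\\ [E_I]K_I(E_I-E_I^* )\end{pmatrix}+[E]BE,\qquad E=(E_L,E_I).$$ The following two statements are equivalent: (i) (Original network) The voltage vector $E=(E_L,E_I)\in\mathbb{R}^{n+m}_{>0}$ is an equilibrium point of the closed-loop system. (ii) (Reduced network) The load voltage vector $E_L\in\mathbb{R}^n_{>0}$ is a solution of the reduced power flow equation $$\mathbf 0_n=Q_L(E_L)+[E_L]B_{\rm red}(E_L-E_L^* ),$$ and the inverter voltage vector is given by $$E_I=W_2\begin{pmatrix}E_L\\ E_I^*\end{pmatrix}\in\mathbb{R}^m_{>0}.$$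
   Context: Network: $n,m\ge 1$ are integers, $\mathcal L=\{1,\dots,n\}$ is the set of load buses, $\mathcal I=\{n+1,\dots,n+m\}$ the set of inverter buses, and $G$ is a connected undirected weighted graph on $\mathcal L\cup\mathcal I$ with edge set $\mathcal E$. The susceptance matrix $B\in\mathbb{R}^{(n+m)\times(n+m)}$ is symmetric with $B_{ij}=B_{ji}>0$ if $\{i,j\}\in\mathcal E$, $B_{ij}=0$ for $i\neq j$ with $\{i,j\}\notin\mathcal E$, and $B_{ii}=-\sum_{j\ne i}B_{ij}$. For a vector $x$, $[x]$ is the diagonal matrix with $x$ on the diagonal; $\mathbf 0_n$ is the zero vector. Block partition according to loads and inverters: $E=(E_L,E_I)$ and $B=\begin{pmatrix}B_{LL}&B_{LI}\\ B_{IL}&B_{II}\end{pmatrix}$. The diagonal matrix $K_I=\mathrm{diag}(K_i)_{i\in\mathcal I}$ contains the gains $K_i<0$ of the quadratic droop controller, $\tau_I=\mathrm{diag}(\tau_i)_{i\in\mathcal I}$ time constants, and $E_I^*=(E_i^* )_{i\in\mathcal I}$ voltage set points. Define $$B_{\rm red}=B_{LL}-B_{LI}(B_{II}+K_I)^{-1}B_{IL},\qquad W_1=-B_{\rm red}^{-1}B_{LI}(B_{II}+K_I)^{-1}K_I\in\mathbb{R}^{n\times m},$$ $$W_2=(B_{II}+K_I)^{-1}\begin{pmatrix}-B_{IL}&K_I\end{pmatrix}\in\mathbb{R}^{m\times(n+m)},\qquad E_L^*=W_1E_I^*.$$ (The inverses exist.) An equilibrium point is a constant vector $E$ making the right-hand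 side of the closed-loop system zero. *)

(* Defs.v *)
From mathcomp Require Import all_boot all_order all_algebra.
From mathcomp Require Import all_classical all_reals all_analysis.

Set Implicit Arguments.
Unset Strict Implicit.
Unset Printing Implicit Defensive.

Import Order.TTheory GRing.Theory Num.Theory.
Import numFieldNormedType.Exports.
Local Open Scope ring_scope.

Definition pos_vec (R : realType) (n : nat) (x : 'cV[R]_n) : Prop :=
  forall i, 0 < x i 0.

(* [x], the diagonal matrix with the column vector x on the diagonal *)
Definition diagv (R : realType) (n : nat) (x : 'cV[R]_n) : 'M[R]_n :=
  diag_mx x^T.

Definition connected_graph (T : finType) (e : rel T) : Prop :=
  [/\ symmetric e, irreflexive e & forall i j, connect e i j].

(* The weight of the edge {i, j} is B i j. *)
Definition susceptance_matrix (R : realType) (N : nat) (e : rel 'I_N)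
    (B : 'M[R]_N) : Prop :=
  [/\ forall i j, B i j = B j i,
      forall i j, e i j -> 0 < B i j,
      forall i j, i != j -> ~~ e i j -> B i j = 0
    & forall i, B i i = - \sum_(j < N | j != i) B i j].

(* C^oo on the open half-line of admissible voltages; on an open set the
   iterated total derivatives [derive1n] are the genuine ones. *)
Definition smooth_on_pos (R : realType) (f : R -> R) : Prop :=
  forall (k : nat) (x : R), 0 < x -> derivable (derive1n k f) x 1.

Definition load_vec (R : realType) (n : nat) (Q : 'I_n -> R -> R)
    (EL : 'cV[R]_n) : 'cV[R]_n :=
  \col_i Q i (EL i 0).

(* The system  dae_mass *m x' = dae_rhs x;  a singular mass matrix encodes
   algebraic constraints. *)
Record dae (R : realType) (N : nat) := Dae {
  dae_mass : 'M[R]_N;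
  dae_rhs : 'cV[R]_N -> 'cV[R]_N }.

Definition equilibrium (R : realType) (N : nat) (S : dae R N)
    (x : 'cV[R]_N) : Prop :=
  dae_rhs S x = 0.

(* Buses are indexed by 'I_(n + m): loads are the first n indices (lshift),
   inverters the last m (rshift), so the L/I blocks of B are its submatrices
   ulsubmx, ursubmx, dlsubmx and drsubmx. *)
Definition closed_loop (R : realType) (n m : nat) (B : 'M[R]_(n + m))
    (KI tauI : 'M[R]_m) (Q : 'I_n -> R -> R) (EIs : 'cV[R]_m) :
    dae R (n + m) :=
  {| dae_mass := block_mx 0 0 0 tauI;
     dae_rhs := fun E =>
       col_mx (load_vec Q (usubmx E))
              (diagv (dsubmx E) *m KI *m (dsubmx E - EIs))
       + diagv E *m B *m E |}.

Definition Bred (R : realType) (n m : nat) (B : 'M[R]_(n + m))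
    (KI : 'M[R]_m) : 'M[R]_n :=
  ulsubmx B - ursubmx B *m invmx (drsubmx B + KI) *m dlsubmx B.

Definition W1 (R : realType) (n m : nat) (B : 'M[R]_(n + m))
    (KI : 'M[R]_m) : 'M[R]_(n, m) :=
  - invmx (Bred B KI) *m ursubmx B *m invmx (drsubmx B + KI) *m KI.

Definition W2 (R : realType) (n m : nat) (B : 'M[R]_(n + m))
    (KI : 'M[R]_m) : 'M[R]_(m, n + m) :=
  invmx (drsubmx B + KI) *m row_mx (- dlsubmx B) KI.

(* E_L^*, the open-circuit load voltages *)
Definition ELs (R : realType) (n m : nat) (B : 'M[R]_(n + m))
    (KI : 'M[R]_m) (EIs : 'cV[R]_m) : 'cV[R]_n :=
  W1 B KI *m EIs.

Definition reduced_power_flow (R : realType) (n m : nat) (B : 'M[R]_(n + m))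
    (KI : 'M[R]_m) (Q : 'I_n -> R -> R) (EIs : 'cV[R]_m)
    (EL : 'cV[R]_n) : Prop :=
  0 = load_vec Q EL + diagv EL *m Bred B KI *m (EL - ELs B KI EIs).

(* Main.v *)
Require Import Defs.
From mathcomp Require Import all_boot all_order all_algebra.
From mathcomp Require Import all_classical all_reals all_analysis.
From mathcomp Require Import ring.

Set Implicit Arguments.
Unset Strict Implicit.

Import Order.TTheory GRing.Theory Num.Theory.
Import numFieldNormedType.Exports.
Local Open Scope ring_scope.

(** The lower block of the equilibrium equation is
    [E_I] ((B_II + K_I) E_I + B_IL E_L - K_I E_I^* ) = 0.  As E_I is positive,
    the factor [E_I] cancels, and solving for E_I gives exactly the formula
    with W_2; substituting it in the upper block (Kron reduction) turns
    B_LL E_L + B_LI E_I into B_red (E_L - E_L^* ).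

    What needs an argument is that B_II + K_I and B_red are invertible.  Both
    are obtained from A = B + diag(0, K_I), whose quadratic form is
      x^T A x = - 1/2 sum_ij B_ij (x_i - x_j)^2 + sum_i K_i x_i^2
    (lemma [susceptance_form]).  Both sums are nonpositive
    contributions, so where the form vanishes x is constant along edges, hence
    constant by connectedness, and zero at some inverter; thus x = 0
    (lemma [grounded_anisotropic]).  B_II + K_I is a principal block of
    A and B_red is its Schur complement, so each of them is injective
    (lemmas [inverter_block_unit] and [Bred_unit]). *)

(** * Invertibility of the inverter block and of the reduced matrix *)

Lemma unitmx_inj (F : fieldType) (n : nat) (A : 'M[F]_n) :
  (forall x : 'cV_n, A *m x = 0 -> x = 0) -> A \in unitmx.
Proof.
move=> injA; rewrite -unitmx_tr -row_free_unit; apply: inj_row_free => v.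
move/(congr1 trmx); rewrite trmx_mul trmxK trmx0 => /injA.
by move/(congr1 trmx); rewrite trmxK trmx0.
Qed.

Lemma mulmx_form (R : comNzRingType) (N : nat) (A : 'M[R]_N) (x : 'cV_N) :
  (x^T *m A *m x) 0 0 = \sum_i \sum_j A i j * x i 0 * x j 0.
Proof.
rewrite -mulmxA mxE; apply: eq_bigr => i _.
rewrite !mxE big_distrr; apply: eq_bigr => j _ /=.
by ring.
Qed.

(** The rows of a susceptance matrix sum to zero, so the square terms in the
    expansion of B_ij (x_i - x_j)^2 cancel. *)
Lemma susceptance_form (R : realType) (N : nat) (e : rel 'I_N) (B : 'M[R]_N)
    (x : 'cV_N) : susceptance_matrix e B ->
  \sum_i \sum_j B i j * (x i 0 - x j 0) ^+ 2 = - 2 * (x^T *m B *m x) 0 0.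
Proof.
case=> symB _ _ diagB.
have row0 i : \sum_j B i j = 0.
  by rewrite (bigD1 i) //= diagB addNr.
have sq0 : \sum_i \sum_j B i j * x i 0 ^+ 2 = 0.
  by apply: big1 => i _; rewrite -big_distrl /= row0 mul0r.
have sq0' : \sum_i \sum_j B i j * x j 0 ^+ 2 = 0.
  rewrite exchange_big -[RHS]sq0; apply: eq_bigr => i _.
  by apply: eq_bigr => j _; rewrite symB.
transitivity (\sum_i \sum_j (B i j * x i 0 ^+ 2 + B i j * x j 0 ^+ 2
                              + - 2 * (B i j * x i 0 * x j 0))).
  by apply: eq_bigr => i _; apply: eq_bigr => j _; ring.
rewrite mulmx_form; under eq_bigr => i _ do
  rewrite big_split big_split -big_distrr /=.
by rewrite big_split big_split -big_distrr sq0 sq0' /= !add0r.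
Qed.

Lemma diag_form (R : comNzRingType) (m : nat) (K : 'M[R]_m) (y : 'cV_m) :
  is_diag_mx K -> (y^T *m K *m y) 0 0 = \sum_i K i i * y i 0 ^+ 2.
Proof.
move/is_diag_mxP => diagK; rewrite mulmx_form; apply: eq_bigr => i _.
rewrite (bigD1 i) //= big1 ?addr0 => [|j nji]; first by ring.
by rewrite diagK 1?eq_sym // !mul0r.
Qed.

Lemma susceptance_ge0 (R : realType) (N : nat) (e : rel 'I_N) (B : 'M[R]_N)
    (i j : 'I_N) : susceptance_matrix e B -> i != j -> 0 <= B i j.
Proof.
case=> _ posB zeroB _ nij; have [/posB/ltW //|neij] := boolP (e i j).
by rewrite zeroB.
Qed.

Lemma connected_const (T : finType) (U : Type) (e : rel T) (f : T -> U) :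
  connected_graph e -> (forall i j, e i j -> f i = f j) ->
  forall i j, f i = f j.
Proof.
case=> _ _ conn fe i j; have /connectP [p] := conn i j.
elim: p i => [|k p IHp] i /=; first by move=> _ ->.
by case/andP=> /fe -> /IHp; apply.
Qed.

Section Grounded.

Variables (R : realType) (n m : nat) (e : rel 'I_(n + m)).
Variables (B : 'M[R]_(n + m)) (K : 'M[R]_m).
Hypotheses (hm : (1 <= m)%N) (he : connected_graph e).
Hypotheses (hB : susceptance_matrix e B).
Hypotheses (diagK : is_diag_mx K) (negK : forall i, K i i < 0).

(** Electrically, the droop gains ground the inverter buses of a connected
    network, which removes the kernel of constant vectors. *)
Lemma grounded_anisotropic (x : 'cV_(n + m)) :
  (x^T *m (B + block_mx 0 0 0 K) *m x) 0 0 = 0 -> x = 0.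
Proof.
rewrite mulmxDr mulmxDl mxE.
have -> : (x^T *m block_mx 0 0 0 K *m x) 0 0 =
    \sum_i K i i * dsubmx x i 0 ^+ 2.
  rewrite -diag_form // -{1 2}(vsubmxK x) tr_col_mx mul_row_block.
  by rewrite !mulmx0 !add0r mul_row_col mul0mx add0r.
have := susceptance_form x hB.
set S := (X in X = _); set D := \sum_i _ => formB form0.
have edge_ge0 i j : 0 <= B i j * (x i 0 - x j 0) ^+ 2.
  have [->|nij] := eqVneq i j; first by rewrite subrr expr0n mulr0.
  by rewrite mulr_ge0 ?sqr_ge0 // (susceptance_ge0 hB).
have row_ge0 i : 0 <= \sum_j B i j * (x i 0 - x j 0) ^+ 2 by apply: sumr_ge0.
have S_ge0 : 0 <= S by apply: sumr_ge0.
have leaf_ge0 i : 0 <= - (K i i * dsubmx x i 0 ^+ 2).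
  by rewrite -mulNr mulr_ge0 ?sqr_ge0 // oppr_ge0 ltW.
have D_le0 : 0 <= - D by rewrite -sumrN sumr_ge0.
have SD : S = 2 * D.
  rewrite formB mulNr -mulrN; congr (_ * _).
  by apply/eqP; rewrite eqr_oppLR -addr_eq0 form0.
have D0 : D = 0.
  apply/eqP; rewrite eq_le -oppr_ge0 D_le0 /=.
  by move: S_ge0; rewrite SD pmulr_rge0.
have S0 : S = 0 by rewrite SD D0 mulr0.
have const : forall i j, x i 0 = x j 0.
  apply: (connected_const he) => i j eij.
  move: S0 => /psumr_eq0P S0; have /psumr_eq0P := S0 (fun i _ => row_ge0 i) i isT.
  move=> /(_ (fun j _ => edge_ge0 i j) j isT) /eqP.
  case: hB => _ /(_ _ _ eij) Bij _ _.
  by rewrite mulf_eq0 gt_eqF //= sqrf_eq0 subr_eq0 => /eqP.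
pose i0 : 'I_m := Ordinal hm.
have ground : x (rshift n i0) 0 = 0.
  have /psumr_eq0P := etrans (sumrN _ _ _) (etrans (congr1 -%R D0) (oppr0 _)).
  move=> /(_ (fun i _ => leaf_ge0 i) i0 isT) /eqP.
  by rewrite oppr_eq0 mulf_eq0 lt_eqF //= sqrf_eq0 mxE => /eqP.
by apply/colP => i; rewrite mxE (const i (rshift n i0)).
Qed.

Lemma inverter_block_unit : drsubmx B + K \in unitmx.
Proof.
apply: unitmx_inj => y My0.
suff /(congr1 dsubmx) : col_mx (0 : 'cV[R]_n) y = 0.
  by rewrite col_mxKd raddf0.
apply: grounded_anisotropic; rewrite -{1}(submxK B) add_block_mx !addr0.
by rewrite -mulmxA mul_block_col !mulmx0 !add0r My0 tr_col_mx mul_row_col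
  trmx0 mul0mx mulmx0 addr0 mxE.
Qed.

(** A kernel vector z of the Schur complement extends to the kernel vector
    (z, - (B_II + K_I)^-1 B_IL z) of the full grounded matrix. *)
Lemma Bred_unit : Bred B K \in unitmx.
Proof.
apply: unitmx_inj => z Bz0.
pose y := - (invmx (drsubmx B + K) *m dlsubmx B *m z).
suff /(congr1 usubmx) : col_mx z y = 0 by rewrite col_mxKu raddf0.
apply: grounded_anisotropic; rewrite -mulmxA -{1}(submxK B) add_block_mx !addr0.
have -> : block_mx (ulsubmx B) (ursubmx B) (dlsubmx B) (drsubmx B + K)
    *m col_mx z y = 0; last by rewrite mulmx0 mxE.
rewrite mul_block_col !mulmxN -!mulmxA mulKVmx ?inverter_block_unit // subrr.
move: Bz0; rewrite /Bred mulmxBl -!mulmxA => ->.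
by rewrite col_mx0.
Qed.

End Grounded.

(** * Elimination of the inverter voltages *)

Lemma diagv_unit (R : realType) (n : nat) (x : 'cV[R]_n) :
  pos_vec x -> diagv x \in unitmx.
Proof.
move=> x_gt0; rewrite unitmxE det_diag unitfE; apply/prodf_neq0 => i _.
by rewrite mxE gt_eqF.
Qed.

Lemma diagv_col_mx (R : realType) (n m : nat) (x : 'cV[R]_n) (y : 'cV[R]_m) :
  diagv (col_mx x y) = block_mx (diagv x) 0 0 (diagv y).
Proof. by rewrite /diagv tr_col_mx diag_mx_row. Qed.

Lemma pos_vec_col_mx (R : realType) (n m : nat) (x : 'cV[R]_n)
    (y : 'cV[R]_m) :
  pos_vec (col_mx x y) <-> pos_vec x /\ pos_vec y.
Proof.
split=> [pos|[posx posy] i].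
  by split=> i; [have := pos (lshift m i) | have := pos (rshift n i)];
    rewrite ?col_mxEu ?col_mxEd.
by rewrite mxE; case: splitP => j _.
Qed.

Lemma closed_loop_rhs (R : realType) (n m : nat) (B : 'M[R]_(n + m))
    (K tau : 'M[R]_m) (Q : 'I_n -> R -> R) (EIs : 'cV[R]_m)
    (EL : 'cV[R]_n) (EI : 'cV[R]_m) :
  dae_rhs (closed_loop B K tau Q EIs) (col_mx EL EI) =
  col_mx
    (load_vec Q EL + diagv EL *m (ulsubmx B *m EL + ursubmx B *m EI))
    (diagv EI *m ((drsubmx B + K) *m EI - (K *m EIs - dlsubmx B *m EL))).
Proof.
rewrite /= col_mxKu col_mxKd diagv_col_mx -{1}(submxK B) -!mulmxA.
rewrite mul_block_col mul_block_col !mul0mx addr0 add0r add_col_mx -mulmxDr.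
congr (col_mx _ (_ *m _)).
by rewrite mulmxBr mulmxDl opprB [RHS]addrACA [LHS]addrC (addrC (dlsubmx B *m EL)).
Qed.

Lemma W2_solves (R : realType) (n m : nat) (B : 'M[R]_(n + m)) (K : 'M[R]_m)
    (EIs : 'cV[R]_m) (EL : 'cV[R]_n) (EI : 'cV[R]_m) :
  drsubmx B + K \in unitmx ->
  (drsubmx B + K) *m EI = K *m EIs - dlsubmx B *m EL <->
  EI = W2 B K *m col_mx EL EIs.
Proof.
move=> uM; rewrite /W2 -mulmxA mul_row_col mulNmx (addrC (- _)).
by split=> [<-|->]; rewrite ?mulKmx ?mulKVmx.
Qed.

(** By the choice of W_1, B_red E_L^* = - B_LI (B_II + K_I)^-1 K_I E_I^*: at the
    load voltages E_L^*, with E_I given by W_2, no current flows at the loads. *)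
Lemma load_current (R : realType) (n m : nat) (B : 'M[R]_(n + m))
    (K : 'M[R]_m) (EIs : 'cV[R]_m) (EL : 'cV[R]_n) :
  Bred B K \in unitmx ->
  ulsubmx B *m EL + ursubmx B *m (W2 B K *m col_mx EL EIs) =
  Bred B K *m (EL - ELs B K EIs).
Proof.
move=> uBred; rewrite mulmxBr /ELs /W1 !mulNmx mulmxN opprK -!mulmxA.
rewrite mulKVmx // /Bred /W2 mulmxBl -!mulmxA mul_row_col mulNmx.
by rewrite !mulmxDr !mulmxN addrA.
Qed.

Unset Implicit Arguments.

Theorem mainTheorem1 (R : realType) (n m : nat) (hn : (1 <= n)%N)
    (hm : (1 <= m)%N)
    (e : rel 'I_(n + m)) (he : connected_graph e)
    (B : 'M[R]_(n + m)) (hB : susceptance_matrix e B)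
    (EIs : 'cV[R]_m) (hEIs : pos_vec EIs)
    (KI : 'M[R]_m) (hKdiag : is_diag_mx KI) (hKneg : forall i, KI i i < 0)
    (tauI : 'M[R]_m) (htaudiag : is_diag_mx tauI)
    (htaupos : forall i, 0 < tauI i i)
    (Q : 'I_n -> R -> R) (hQ : forall i, smooth_on_pos (Q i))
    (EL : 'cV[R]_n) (EI : 'cV[R]_m) :
  (pos_vec (col_mx EL EI) /\
   equilibrium (closed_loop B KI tauI Q EIs) (col_mx EL EI))
  <->
  ((pos_vec EL /\ reduced_power_flow B KI Q EIs EL) /\
   (EI = W2 B KI *m col_mx EL EIs /\ pos_vec EI)).
Proof.
have uM := inverter_block_unit hm he hB hKdiag hKneg.
have uBred := Bred_unit hm he hB hKdiag hKneg.
rewrite /equilibrium closed_loop_rhs /reduced_power_flow -mulmxA.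
rewrite -load_current // pos_vec_col_mx -col_mx0.
split=> [[[posL posI] /eq_col_mx [top bottom]]|[[posL flow] [EIE posI]]].
- have EIE : EI = W2 B KI *m col_mx EL EIs.
    apply/W2_solves => //; apply/eqP; rewrite -subr_eq0.
    by rewrite -(mulKmx (diagv_unit posI) (_ - _)) bottom mulmx0.
  by rewrite -EIE.
- split=> //; have /W2_solves -> // := EIE.
  by rewrite subrr mulmx0; congr col_mx; rewrite {1}EIE.
Qed.
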